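(* Let $d,r\ge2$ and $e\ge1$. The homomorphism $$\psi\colon B(de,e,r)\to C_\infty^e\ltimes B(\infty,\infty,r)$$ given by $\psi(z)=z$, $\psi(t_i)=t_i$ and $\psi(s_j)=s_j$ for $i\in\mathbb{Z}$ and $3\le j\le r$ is an isomorphism.
   Context: The usual braid relations on $S=\{s_3,\ldots,s_r\}$ are $s_is_j=s_js_i$ for $|i-j|\ge 2$ and $s_is_{i+1}s_i=s_{i+1}s_is_{i+1}$ for $3\le i\le r-1$. If $r=2$ then $S=\emptyset$ and all relations involving some $s_j$ are absent. For $k\ge 0$, $\langle t_1t_0\rangle^k$ denotes the alternating product $t_1t_0t_1\cdots$ with exactly $k$ factors. $B(\infty,\infty,r)$ ($r\ge2$) is the group with generators $\{t_0,t_1\}\cup S$ and relations: the usual braid relations on $S$; $s_3t_is_3=t_is_3t_i$ for $i=0,1$; $s_jt_i=t_is_j$ for $i=0,1$, $4\le j\le r$; $s_3(t_1t_0)s_3(t_1t_0)=(t_1t_0)s_3(t_1t_0)s_3$. $B(de,e,r)$ is the braid group of the complex reflection group $G(de,e,r)$; by Broué–Malle–Rouquier it is (and may be taken by definition to be) the group with generators $\{z,t_0,t_1\}\cup S$ and the relations just listed for $B(\infty,\infty,r)$ together with $zt_1t_0=t_1t_0z$; $z\langle t_1t_0\rangle^e=t_0z\langle t_1t_0\rangle^{e-1}$; $zs_j=s_jz$ for $3\le j\le r$. In both groups the elements $t_i$ for all $i\in\mathbb{Z}$ are defined from $t_0,t_1$ by requiring $t_it_{i-1}=t_1t_0$ for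 all $i\in\mathbb{Z}$. $C_\infty=\langle c\rangle$ is an infinite cyclic group acting on $B(\infty,\infty,r)$ by automorphisms $c\cdot t_i=t_{i-1}$ ($i\in\mathbb{Z}$), $c\cdot s_j=s_j$ ($3\le j\le r$). Put $z=c^e$ and $C_\infty^e=\langle z\rangle$, so in the semidirect product $C_\infty^e\ltimes B(\infty,\infty,r)$ one has $zt_iz^{-1}=t_{i-e}$ and $zs_jz^{-1}=s_j$. *)

(* Defs.v *)
From HB Require Import structures.
From mathcomp Require Import all_boot all_order all_algebra.
From mathcomp Require Import boolp.
From mathcomp Require Import zify.

Set Implicit Arguments.
Unset Strict Implicit.
Unset Printing Implicit Defensive.

Local Open Scope group_scope.
Local Open Scope quotient_scope.

(* The group <X | R> is the quotient of the algebra of formal group           *)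
(* expressions over X by the smallest congruence which contains the group     *)
(* axioms and the relations u = v for (u, v) in R.                            *)

Inductive term (X : Type) : Type :=
  | Gen of X
  | One
  | Mul of term X & term X
  | Inv of term X.
Arguments One {X}.

HB.instance Definition _ X := gen_eqMixin (term X).
HB.instance Definition _ X := gen_choiceMixin (term X).
HB.instance Definition _ X := hasMul.Build (term X) (@Mul X).
HB.instance Definition _ X := hasOne.Build (term X) (@One X).
HB.instance Definition _ X := hasInv.Build (term X) (@Inv X).

Inductive pres_eq (X : Type) (R : term X -> term X -> Prop) :
    term X -> term X -> Prop :=
  | PresRel u v of R u v : pres_eq R u v
  | PresRefl u : pres_eq R u u
  | PresSym u v of pres_eq R u v : pres_eq R v u
  | PresTrans u v w of pres_eq R u v & pres_eq R v w : pres_eq R u w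
  | PresMul u u' v v' of pres_eq R u u' & pres_eq R v v' :
      pres_eq R (u * v) (u' * v')
  | PresInv u u' of pres_eq R u u' : pres_eq R u^-1 u'^-1
  | PresA u v w : pres_eq R (u * (v * w)) (u * v * w)
  | Pres1l u : pres_eq R (1 * u) u
  | Pres1r u : pres_eq R (u * 1) u
  | PresVl u : pres_eq R (u^-1 * u) 1
  | PresVr u : pres_eq R (u * u^-1) 1.

Section PresentedGroup.

Variables (X : Type) (R : term X -> term X -> Prop).

Definition pres_rel : rel (term X) := fun u v => `[< pres_eq R u v >].

Lemma pres_rel_refl : reflexive pres_rel.
Proof. by move=> u; apply/asboolP; apply: PresRefl. Qed.

Lemma pres_rel_sym : symmetric pres_rel.
Proof. by move=> u v; apply/asboolP/asboolP; apply: PresSym. Qed.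

Lemma pres_rel_trans : transitive pres_rel.
Proof.
by move=> v u w /asboolP uv /asboolP vw; apply/asboolP; apply: PresTrans uv vw.
Qed.

Canonical pres_equiv :=
  EquivRel pres_rel pres_rel_refl pres_rel_sym pres_rel_trans.

Definition presented := {eq_quot pres_equiv}.
HB.instance Definition _ := Choice.on presented.

Definition pres_pi (u : term X) : presented := \pi_presented u.

Lemma pres_piE u v : pres_eq R u v <-> pres_pi u = pres_pi v.
Proof.
split=> [uv|/eqmodP/asboolP //].
by apply/eqmodP/asboolP.
Qed.

Lemma pres_reprK (x : presented) : pres_pi (repr x) = x.
Proof. exact: reprK. Qed.

Definition pres_mul (x y : presented) := pres_pi (repr x * repr y).
Definition pres_inv (x : presented) := pres_pi (repr x)^-1.
Definition pres_one := pres_pi 1.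

Lemma pres_mulE u v : pres_mul (pres_pi u) (pres_pi v) = pres_pi (u * v).
Proof. by apply/pres_piE; apply: PresMul; apply/pres_piE; rewrite pres_reprK. Qed.

Lemma pres_invE u : pres_inv (pres_pi u) = pres_pi u^-1.
Proof. by apply/pres_piE; apply: PresInv; apply/pres_piE; rewrite pres_reprK. Qed.

Lemma pres_mulA : associative pres_mul.
Proof.
move=> x y z; rewrite -(pres_reprK x) -(pres_reprK y) -(pres_reprK z).
by rewrite !pres_mulE; apply/pres_piE; apply: PresA.
Qed.

Lemma pres_mul1g : left_id pres_one pres_mul.
Proof.
by move=> x; rewrite -(pres_reprK x) pres_mulE; apply/pres_piE; apply: Pres1l.
Qed.

Lemma pres_mulg1 : right_id pres_one pres_mul.
Proof.
by move=> x; rewrite -(pres_reprK x) pres_mulE; apply/pres_piE; apply: Pres1r.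
Qed.

Lemma pres_mulVg : left_inverse pres_one pres_inv pres_mul.
Proof.
move=> x; rewrite -(pres_reprK x) pres_invE pres_mulE.
by apply/pres_piE; apply: PresVl.
Qed.

Lemma pres_mulgV : right_inverse pres_one pres_inv pres_mul.
Proof.
move=> x; rewrite -(pres_reprK x) pres_invE pres_mulE.
by apply/pres_piE; apply: PresVr.
Qed.

HB.instance Definition _ :=
  isGroup.Build presented pres_mulA pres_mul1g pres_mulg1 pres_mulVg pres_mulgV.

Definition pres_gen (x : X) : presented := pres_pi (Gen x).

Lemma pres_piM u v : pres_pi (u * v) = pres_pi u * pres_pi v.
Proof. by rewrite -pres_mulE. Qed.

Lemma pres_piV u : pres_pi u^-1 = (pres_pi u)^-1.
Proof. by rewrite -pres_invE. Qed.

Lemma pres_pi1 : pres_pi 1 = 1. Proof. by []. Qed.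

Variable H : groupType.

Fixpoint term_eval (f : X -> H) (u : term X) : H :=
  match u with
  | Gen x => f x
  | One => 1
  | Mul u v => term_eval f u * term_eval f v
  | Inv u => (term_eval f u)^-1
  end.

Section Lift.

Variables (f : X -> H).
Hypothesis fR : forall u v, R u v -> term_eval f u = term_eval f v.

Lemma pres_eq_eval u v : pres_eq R u v -> term_eval f u = term_eval f v.
Proof.
elim=> //=.
- by move=> a b c _ -> _ ->.
- by move=> a a' b b' _ -> _ ->.
- by move=> a a' _ ->.
- by move=> *; rewrite mulgA.
- by move=> *; rewrite mul1g.
- by move=> *; rewrite mulg1.
- by move=> *; rewrite mulVg.
- by move=> *; rewrite mulgV.
Qed.

Definition pres_lift (x : presented) : H := term_eval f (repr x).

Lemma pres_lift_pi u : pres_lift (pres_pi u) = term_eval f u.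
Proof. by apply: pres_eq_eval; apply/pres_piE; rewrite pres_reprK. Qed.

Lemma pres_lift_gen x : pres_lift (pres_gen x) = f x.
Proof. exact: pres_lift_pi. Qed.

Lemma pres_liftM : {morph pres_lift : x y / x * y}.
Proof.
move=> x y; rewrite -(pres_reprK x) -(pres_reprK y) -pres_piM.
by rewrite !pres_lift_pi.
Qed.

End Lift.

Lemma pres_morph_ext (f g : presented -> H) :
    {morph f : x y / x * y} -> {morph g : x y / x * y} ->
  (forall x, f (pres_gen x) = g (pres_gen x)) -> f =1 g.
Proof.
have m1 (h : presented -> H) : {morph h : x y / x * y} -> h 1 = 1.
  by move=> hM; apply: (@mulgI _ (h 1)); rewrite -hM !mulg1.
have mV (h : presented -> H) :
    {morph h : x y / x * y} -> {morph h : x / x^-1}.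
  move=> hM x; apply: (@mulgI _ (h x)); rewrite -hM !mulgV; exact: m1.
move=> fM gM fg x; rewrite -(pres_reprK x); elim: (repr x) => {x}.
- exact: fg.
- by rewrite (m1 f fM) (m1 g gM).
- by move=> u eu v ev; rewrite pres_piM fM gM eu ev.
- by move=> u eu; rewrite pres_piV (mV f fM) (mV g gM) eu.
Qed.

End PresentedGroup.

Definition zpow (G : groupType) (g : G) (n : int) : G :=
  match n with Posz m => g ^+ m | Negz m => g ^- m.+1 end.

Lemma zpowS (G : groupType) (g : G) n : zpow g (n + 1)%R = zpow g n * g.
Proof.
case: n => [n|[|n]].
- by rewrite -PoszD addn1 /= expgSr.
- by rewrite /= mulVg.
- have -> : (Negz n.+1 + 1)%R = Negz n by lia.
  by rewrite /= [g ^+ n.+2]expgS invgM mulgVK.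
Qed.

Lemma zpowP (G : groupType) (g : G) n : zpow g (n - 1)%R = zpow g n * g^-1.
Proof. by rewrite -{2}[n](GRing.subrK 1%R) zpowS mulgK. Qed.

Lemma zpowD (G : groupType) (g : G) m n :
  zpow g (m + n)%R = zpow g m * zpow g n.
Proof.
elim/int_rec: n => [|n IH|n IH].
- by rewrite GRing.addr0 mulg1.
- by rewrite -addn1 PoszD GRing.addrA !zpowS IH mulgA.
- by rewrite -addn1 PoszD GRing.opprD GRing.addrA !zpowP IH mulgA.
Qed.

Lemma zpowN (G : groupType) (g : G) n : zpow g (- n)%R = (zpow g n)^-1.
Proof. by apply: (@mulIg _ (zpow g n)); rewrite -zpowD GRing.addNr mulVg. Qed.

Section CyclicSubgroup.

Variables (G : groupType) (g : G).

Definition cyc : {pred G} := fun x => `[< exists n : int, x = zpow g n >].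

Lemma cyc_closed : group_closed cyc.
Proof.
split; first by apply/asboolP; exists 0%R.
move=> x y /asboolP[m ->] /asboolP[n ->]; apply/asboolP.
by exists (m - n)%R; rewrite zpowD zpowN.
Qed.

Definition cyc_group := {x : G | x \in cyc}.
HB.instance Definition _ := SubChoice.on cyc_group.
HB.instance Definition _ :=
  SubChoice_isSubGroup.Build G (mem cyc) cyc_group cyc_closed.

Lemma cyc_id : g \in cyc.
Proof. by apply/asboolP; exists 1%R. Qed.

Definition cyc_gen : cyc_group := exist _ g cyc_id.

End CyclicSubgroup.

(* Actions of a group A on a group G by automorphisms.                        *)
Record gaction (A G : groupType) := GAction {
  gact :> A -> G -> G;
  gactM : forall a, {morph gact a : x y / x * y};
  gact1 : forall x, gact 1 x = x;
  gactA : forall a b x, gact (a * b) x = gact a (gact b x)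
}.

Lemma gact_bij (A G : groupType) (act : gaction A G) a : bijective (act a).
Proof.
exists (act a^-1) => x; rewrite -gactA ?mulVg ?mulgV; exact: gact1.
Qed.

Lemma gact_one (A G : groupType) (act : gaction A G) a : act a 1 = 1.
Proof. by apply: (@mulgI _ (act a 1)); rewrite -gactM !mulg1. Qed.

(* The pair with components a : A and x : G stands for the product x a, so    *)
(* that (x a) (y b) = (x (a . y)) (a b).                                      *)
Record semidirect (A G : groupType) (act : gaction A G) := SemiDirect {
  sd_act : A;
  sd_nrm : G
}.

HB.instance Definition _ A G act := gen_eqMixin (@semidirect A G act).
HB.instance Definition _ A G act := gen_choiceMixin (@semidirect A G act).

Section SemiDirectProduct.

Variables (A G : groupType) (act : gaction A G).
Notation sd := (semidirect act).

Definition sd_mul (u v : sd) : sd :=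
  SemiDirect act (sd_act u * sd_act v) (sd_nrm u * act (sd_act u) (sd_nrm v)).
Definition sd_one : sd := SemiDirect act 1 1.
Definition sd_inv (u : sd) : sd :=
  SemiDirect act (sd_act u)^-1 (act (sd_act u)^-1 (sd_nrm u)^-1).

Lemma sd_mulA : associative sd_mul.
Proof. by case=> a x [b y] [c z]; rewrite /sd_mul /= gactM gactA !mulgA. Qed.

Lemma sd_mul1g : left_id sd_one sd_mul.
Proof. by case=> a x; rewrite /sd_mul /= gact1 !mul1g. Qed.

Lemma sd_mulg1 : right_id sd_one sd_mul.
Proof. by case=> a x; rewrite /sd_mul /= gact_one !mulg1. Qed.

Lemma sd_mulVg : left_inverse sd_one sd_inv sd_mul.
Proof.
by case=> a x; rewrite /sd_mul /sd_inv /= -gactM !mulVg gact_one.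
Qed.

Lemma sd_mulgV : right_inverse sd_one sd_inv sd_mul.
Proof.
by case=> a x; rewrite /sd_mul /sd_inv /= -gactA !mulgV gact1 mulgV.
Qed.

HB.instance Definition _ :=
  isGroup.Build sd sd_mulA sd_mul1g sd_mulg1 sd_mulVg sd_mulgV.

Definition sd_inl (a : A) : sd := SemiDirect act a 1.
Definition sd_inr (x : G) : sd := SemiDirect act 1 x.

Lemma sd_inlM : {morph sd_inl : a b / a * b}.
Proof.
move=> a b; change (sd_inl (a * b) = sd_mul (sd_inl a) (sd_inl b)).
by rewrite /sd_mul /= gact_one mulg1.
Qed.

Lemma sd_inrM : {morph sd_inr : x y / x * y}.
Proof.
move=> x y; change (sd_inr (x * y) = sd_mul (sd_inr x) (sd_inr y)).
by rewrite /sd_mul /= gact1 mulg1.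
Qed.

Lemma sd_conj a x : sd_inl a * sd_inr x * (sd_inl a)^-1 = sd_inr (act a x).
Proof.
suff -> : sd_inl a * sd_inr x = sd_inr (act a x) * sd_inl a by rewrite mulgK.
change (sd_mul (sd_inl a) (sd_inr x) = sd_mul (sd_inr (act a x)) (sd_inl a)).
by rewrite /sd_mul /= gact1 !mulg1 !mul1g.
Qed.

End SemiDirectProduct.

Lemma subgact_subproof (A G : groupType) (g : A) (act : gaction A G)
    (a b : cyc_group g) x :
  act (val (a * b)) x = act (val a) (act (val b) x).
Proof. by rewrite valM gactA. Qed.

Definition cyc_gact (A G : groupType) (g : A) (act : gaction A G) :
    gaction (cyc_group g) G :=
  @GAction (cyc_group g) G (fun a => act (val a))
    (fun a => gactM act (val a)) (gact1 act) (subgact_subproof act).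

(* altprod a b k is the alternating product a b a ... with k factors.         *)
Fixpoint altprod (M : baseUMagmaType) (a b : M) (k : nat) : M :=
  if k is k'.+1 then a * altprod b a k' else 1.

(* The sequence defined by t_i t_{i-1} = t_1 t_0 for all i, see tseq_spec and *)
(* tseq_unique.                                                               *)
Fixpoint tseq_up (G : groupType) (t0 t1 : G) (n : nat) : G :=
  if n is n'.+1 then t1 * t0 * (tseq_up t0 t1 n')^-1 else t0.
Fixpoint tseq_down (G : groupType) (t0 t1 : G) (n : nat) : G :=
  if n is n'.+1 then (tseq_down t0 t1 n')^-1 * (t1 * t0) else t0.
Definition tseq (G : groupType) (t0 t1 : G) (i : int) : G :=
  match i with
  | Posz n => tseq_up t0 t1 n
  | Negz n => tseq_down t0 t1 n.+1
  end.

Section TSeq.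

Variables (G : groupType) (t0 t1 : G).

Lemma tseq0 : tseq t0 t1 0%R = t0. Proof. by []. Qed.
Lemma tseq1 : tseq t0 t1 1%R = t1. Proof. by rewrite /= mulgK. Qed.

Lemma tseq_spec i : tseq t0 t1 i * tseq t0 t1 (i - 1)%R = t1 * t0.
Proof.
case: i => [[|n]|n].
- by rewrite /= mulVKg.
- have -> : (Posz n.+1 - 1)%R = Posz n by lia.
  by rewrite /= mulgVK.
- have -> : (Negz n - 1)%R = Negz n.+1 by lia.
  by rewrite /= mulVKg.
Qed.

Lemma tseqS i : tseq t0 t1 (i + 1)%R = t1 * t0 * (tseq t0 t1 i)^-1.
Proof.
by have := tseq_spec (i + 1)%R; rewrite GRing.addrK => <-; rewrite mulgK.
Qed.

Lemma tseqP i : tseq t0 t1 (i - 1)%R = (tseq t0 t1 i)^-1 * (t1 * t0).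
Proof. by rewrite -(tseq_spec i) mulKg. Qed.

Lemma tseq_unique (t : int -> G) :
    t 0%R = t0 -> t 1%R = t1 ->
  (forall i, t i * t (i - 1)%R = t1 * t0) -> t =1 tseq t0 t1.
Proof.
move=> e0 e1 et; elim/int_rec=> [|n IH|n IH] //.
- rewrite -addn1 PoszD tseqS -IH -(et (Posz n + 1)%R).
  by rewrite GRing.addrK mulgK.
- rewrite -addn1 PoszD GRing.opprD tseqP -IH -(et (- Posz n)%R).
  by rewrite mulKg.
Qed.

End TSeq.

Lemma tseq_shift (G : groupType) (t0 t1 : G) k i :
  tseq (tseq t0 t1 k) (tseq t0 t1 (k + 1)%R) i = tseq t0 t1 (k + i)%R.
Proof.
apply/esym.
apply: (@tseq_unique G _ _ (fun i => tseq t0 t1 (k + i)%R)) => [||j] //.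
- by rewrite GRing.addr0.
- have := tseq_spec t0 t1 (k + 1)%R; rewrite GRing.addrK => ->.
  by rewrite GRing.addrA tseq_spec.
Qed.

Lemma tseq_morph (G H : groupType) (f : G -> H) t0 t1 :
    {morph f : x y / x * y} ->
  forall i, f (tseq t0 t1 i) = tseq (f t0) (f t1) i.
Proof.
move=> fM; apply: (@tseq_unique H (f t0) (f t1) (fun i => f (tseq t0 t1 i))).
- by [].
- by rewrite tseq1.
- by move=> i; rewrite -!fM tseq_spec.
Qed.

(* The index set {3, ..., r} of S.                                            *)
Definition sidx (r : nat) := {j : nat | (3 <= j <= r)%N}.

Inductive Binf_rel (r : nat) (M : baseUMagmaType) (t0 t1 : M)
    (s : sidx r -> M) : M -> M -> Prop :=
  | Binf_ss (i j : sidx r) of (val i + 2 <= val j)%N :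
      Binf_rel t0 t1 s (s i * s j) (s j * s i)
  | Binf_sss (i j : sidx r) of val j = (val i).+1 :
      Binf_rel t0 t1 s (s i * s j * s i) (s j * s i * s j)
  | Binf_s3t (s3 : sidx r) (t : M) of val s3 = 3 & t = t0 \/ t = t1 :
      Binf_rel t0 t1 s (s s3 * t * s s3) (t * s s3 * t)
  | Binf_st (j : sidx r) (t : M) of (4 <= val j)%N & t = t0 \/ t = t1 :
      Binf_rel t0 t1 s (s j * t) (t * s j)
  | Binf_s3tt (s3 : sidx r) of val s3 = 3 :
      Binf_rel t0 t1 s (s s3 * (t1 * t0) * s s3 * (t1 * t0))
                       ((t1 * t0) * s s3 * (t1 * t0) * s s3).

Inductive Binf_gen (r : nat) : Type :=
  | GenInf_t0
  | GenInf_t1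
  | GenInf_s of sidx r.
Arguments GenInf_t0 {r}.
Arguments GenInf_t1 {r}.

Definition Binf_relator (r : nat) :
    term (Binf_gen r) -> term (Binf_gen r) -> Prop :=
  Binf_rel (Gen GenInf_t0) (Gen GenInf_t1) (fun j => Gen (GenInf_s j)).

Definition Binf (r : nat) := presented (@Binf_relator r).
HB.instance Definition _ r := Group.on (Binf r).

Section Binf.

Variable r : nat.

Definition Binf_t0 : Binf r := pres_gen _ GenInf_t0.
Definition Binf_t1 : Binf r := pres_gen _ GenInf_t1.
Definition Binf_s (j : sidx r) : Binf r := pres_gen _ (GenInf_s j).
Definition Binf_t (i : int) : Binf r := tseq Binf_t0 Binf_t1 i.

Lemma Binf_relP (u v : Binf r) :
  Binf_rel Binf_t0 Binf_t1 Binf_s u v -> u = v.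
Proof.
have rel w w' : Binf_relator w w' ->
    pres_pi (@Binf_relator r) w = pres_pi _ w'.
  by move=> R; apply/pres_piE/PresRel.
case=> {u v} [i j ij|i j ij|i t i3|j t j4|i i3].
- by have := rel _ _ (Binf_ss _ _ _ ij); rewrite !pres_piM.
- by have := rel _ _ (Binf_sss _ _ _ ij); rewrite !pres_piM.
- by case=> ->; [have := rel _ _ (Binf_s3t _ i3 (or_introl erefl))
               | have := rel _ _ (Binf_s3t _ i3 (or_intror erefl))];
     rewrite !pres_piM.
- by case=> ->; [have := rel _ _ (Binf_st _ j4 (or_introl erefl))
               | have := rel _ _ (Binf_st _ j4 (or_intror erefl))];
     rewrite !pres_piM.
- by have := rel _ _ (Binf_s3tt _ _ _ i3); rewrite !pres_piM.
Qed.

Section Lift.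

Variables (H : groupType) (t0 t1 : H) (s : sidx r -> H).

Definition Binf_val (g : Binf_gen r) : H :=
  match g with GenInf_t0 => t0 | GenInf_t1 => t1 | GenInf_s j => s j end.

Hypothesis rels : forall u v, Binf_rel t0 t1 s u v -> u = v.

Lemma Binf_val_rel (u v : term (Binf_gen r)) :
  Binf_relator u v -> term_eval Binf_val u = term_eval Binf_val v.
Proof.
case=> [i j ij|i j ij|i t i3|j t j4|i i3]; first 1 last.
- exact: rels (Binf_sss _ _ _ ij).
- by case=> ->; apply: rels; apply: (Binf_s3t _ i3); [left|right].
- by case=> ->; apply: rels; apply: (Binf_st _ j4); [left|right].
- exact: rels (Binf_s3tt _ _ _ i3).
- exact: rels (Binf_ss _ _ _ ij).
Qed.

End Lift.

Lemma Binf_ext (H : groupType) (f g : Binf r -> H) :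
    {morph f : x y / x * y} -> {morph g : x y / x * y} ->
    f Binf_t0 = g Binf_t0 -> f Binf_t1 = g Binf_t1 ->
  (forall j, f (Binf_s j) = g (Binf_s j)) -> f =1 g.
Proof. by move=> fM gM e0 e1 es; apply: pres_morph_ext => // -[]. Qed.

(* The relations also hold for every pair of consecutive t_i's.               *)
Lemma Binf_shift (H : groupType) (t0 t1 : H) (s : sidx r -> H) :
    (forall u v, Binf_rel t0 t1 s u v -> u = v) ->
  forall k u v,
    Binf_rel (tseq t0 t1 k) (tseq t0 t1 (k + 1)%R) s u v -> u = v.
Proof.
move=> rels.
have D k : tseq t0 t1 (k + 1)%R * tseq t0 t1 k = t1 * t0.
  by have := tseq_spec t0 t1 (k + 1)%R; rewrite GRing.addrK.
have sD (s3 : sidx r) : val s3 = 3 ->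
    s s3 * (t1 * t0) * s s3 * (t1 * t0) = (t1 * t0) * s s3 * (t1 * t0) * s s3.
  by move=> e; apply: rels (Binf_s3tt _ _ _ e).
have st k (j : sidx r) : (4 <= val j)%N ->
    s j * tseq t0 t1 k = tseq t0 t1 k * s j.
  move=> j4.
  have c0 : commute (s j) t0.
    by apply: rels; apply: (Binf_st _ j4); left.
  have c1 : commute (s j) t1.
    by apply: rels; apply: (Binf_st _ j4); right.
  have cD := commuteM c1 c0.
  have : commute (s j) (tseq t0 t1 k).
    elim/int_rec: k => [|n IH|n IH] //.
      rewrite -addn1 PoszD tseqS; apply: commuteM => //; exact: commuteV.
    rewrite -addn1 PoszD GRing.opprD tseqP.
    by apply: commuteM => //; exact: commuteV.
  by [].
have braid k (s3 : sidx r) : val s3 = 3 ->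
    s s3 * tseq t0 t1 k * s s3 = tseq t0 t1 k * s s3 * tseq t0 t1 k.
  move=> e3.
  have b0 : s s3 * t0 * s s3 = t0 * s s3 * t0.
    by apply: rels; apply: (Binf_s3t _ e3); left.
  have b1 : s s3 * t1 * s s3 = t1 * s s3 * t1.
    by apply: rels; apply: (Binf_s3t _ e3); right.
  have {}sD := sD _ e3.
  set x := s s3 in b0 b1 sD *.
  (* y = x (t1 t0) x carries t_{k-1} to t_k by conjugation *)
  have [y yE] : exists y, y = x * (t1 * t0) * x by eexists.
  have yD : y * (t1 * t0) = t1 * t0 * y by rewrite yE sD !mulgA.
  have y0 : y * t0 = t1 * y.
    rewrite yE !mulgA.
    rewrite -[x * t1 * t0 * x * t0]mulgA -[x * t1 * t0 * (x * t0)]mulgA.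
    rewrite [t0 * (x * t0)]mulgA -b0 !mulgA b1.
    by rewrite -!mulgA.
  have yt i : y * tseq t0 t1 i = tseq t0 t1 (i + 1)%R * y.
    have c : tseq t0 t1 (i + 1)%R = y * tseq t0 t1 i * y^-1.
      apply/esym.
      have morphc : {morph (fun g => y * g * y^-1) : a b / a * b}.
        by move=> a b /=; rewrite !mulgA mulgVK.
      rewrite [LHS](tseq_morph t0 t1 morphc) /=.
      have -> : y * t0 * y^-1 = t1 by rewrite y0 mulgK.
      have -> : y * t1 * y^-1 = tseq t0 t1 (1 + 1)%R.
        rewrite tseqS tseq1; apply: (@mulIg _ y); rewrite mulgVK.
        apply: (@mulIg _ t0); rewrite -(mulgA y) yD -!mulgA y0.
        by rewrite (mulgA t1^-1) mulVg mul1g.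
      by rewrite -[X in tseq X _ _](tseq1 t0 t1) tseq_shift GRing.addrC.
    by rewrite c mulgVK.
  have key i : x * tseq t0 t1 (i + 1)%R * (tseq t0 t1 i * x * tseq t0 t1 i) =
      tseq t0 t1 (i + 1)%R * x * tseq t0 t1 (i + 1)%R * tseq t0 t1 i * x.
    by have := yt i; rewrite yE -(D i) !mulgA.
  elim/int_rec: k => [|n IH|n IH] //.
  - rewrite -addn1 PoszD; have := key (Posz n); rewrite -{}IH !mulgA.
    by move=> /mulIg/mulIg.
  - rewrite -addn1 PoszD GRing.opprD; have := key (- Posz n - 1)%R.
    rewrite GRing.subrK -IH -!mulgA.
    by move=> /mulgI/mulgI; rewrite !mulgA => ->.
move=> k u v; case=> {u v} [i j ij|i j ij|i t i3|j t j4|i i3].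
- exact: rels (Binf_ss _ _ _ ij).
- exact: rels (Binf_sss _ _ _ ij).
- by case=> ->; apply: braid.
- by case=> ->; apply: st.
- by rewrite !D; apply: sD.
Qed.

End Binf.

Definition Cinf : Type := int.
HB.instance Definition _ := Choice.on Cinf.
HB.instance Definition _ := isGroup.Build Cinf (@GRing.addrA int)
  (@GRing.add0r int) (@GRing.addr0 int) (@GRing.addNr int) (@GRing.addrN int).

Definition c : Cinf := 1%R : int.

Lemma Cinf_mulE (a b : Cinf) : a * b = ((a : int) + (b : int))%R.
Proof. by []. Qed.

Lemma zpow_c (k : int) : zpow c k = k.
Proof.
elim/int_rec: k => [|n IH|n IH] //.
- by rewrite -addn1 PoszD zpowS IH.
- by rewrite -addn1 PoszD GRing.opprD zpowP IH.
Qed.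

Section Action.

Variable r : nat.

(* c ^ k sends t_i to t_{i-k} and s_j to s_j.                                 *)
Definition shift_fun (k : Cinf) : Binf r -> Binf r :=
  pres_lift (Binf_val (Binf_t r (- (k : int))%R)
                      (Binf_t r (- (k : int) + 1)%R) (@Binf_s r)).

Lemma shift_rel k u v : Binf_relator u v ->
  term_eval (Binf_val (Binf_t r (- (k : int))%R)
                      (Binf_t r (- (k : int) + 1)%R) (@Binf_s r)) u =
  term_eval (Binf_val (Binf_t r (- (k : int))%R)
                      (Binf_t r (- (k : int) + 1)%R) (@Binf_s r)) v.
Proof.
by apply: Binf_val_rel => {}u {}v; apply: Binf_shift; apply: Binf_relP.
Qed.

Lemma shift_funM k : {morph shift_fun k : x y / x * y}.
Proof. by apply: pres_liftM; apply: shift_rel. Qed.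

Lemma shift_s k j : shift_fun k (Binf_s j) = Binf_s j.
Proof. by apply: pres_lift_gen; apply: shift_rel. Qed.

Lemma shift_t k i : shift_fun k (Binf_t r i) = Binf_t r (i - (k : int))%R.
Proof.
rewrite [LHS](tseq_morph _ _ (shift_funM k)).
rewrite /Binf_t0 /Binf_t1 /shift_fun.
rewrite !(pres_lift_gen (shift_rel k)) /=.
by rewrite tseq_shift GRing.addrC.
Qed.

Lemma Binf_t_0 : Binf_t r 0%R = Binf_t0 r.
Proof. by []. Qed.

Lemma Binf_t_1 : Binf_t r 1%R = Binf_t1 r.
Proof. exact: tseq1. Qed.

Lemma shift1 x : shift_fun 1 x = x.
Proof.
apply: (Binf_ext (g := id)) x => [|||| j] //; first exact: shift_funM.
- by rewrite -[X in shift_fun 1 X]Binf_t_0 shift_t GRing.subr0.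
- by rewrite -[X in shift_fun 1 X]Binf_t_1 shift_t GRing.subr0 Binf_t_1.
- exact: shift_s.
Qed.

Lemma shiftM (k l : Cinf) x :
  shift_fun (k * l) x = shift_fun k (shift_fun l x).
Proof.
have e i : (i - (k * l)%g = i - l - k :> int)%R.
  by rewrite Cinf_mulE GRing.opprD GRing.addrA GRing.addrAC.
apply: (Binf_ext (g := fun x => shift_fun k (shift_fun l x))) x => [|y z|||j].
- exact: shift_funM.
- by rewrite !shift_funM.
- by rewrite -Binf_t_0 !shift_t e.
- by rewrite -Binf_t_1 !shift_t e.
- by rewrite !shift_s.
Qed.

Definition shift : gaction Cinf (Binf r) :=
  GAction shift_funM shift1 shiftM.

Lemma shift_ct i : shift c (Binf_t r i) = Binf_t r (i - 1)%R.
Proof. exact: shift_t. Qed.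

Lemma shift_cs j : shift c (Binf_s j) = Binf_s j.
Proof. exact: shift_s. Qed.

End Action.

Definition Cinfe (e : nat) := cyc_group (c ^+ e).
HB.instance Definition _ e := Group.on (Cinfe e).
Definition zC (e : nat) : Cinfe e := cyc_gen (c ^+ e).

Definition shifte (e r : nat) : gaction (Cinfe e) (Binf r) :=
  cyc_gact (c ^+ e) (shift r).

Definition CBinf (e r : nat) := semidirect (shifte e r).
HB.instance Definition _ e r := Group.on (CBinf e r).

Section CBinf.

Variables e r : nat.

Definition CBinf_z : CBinf e r := sd_inl (shifte e r) (zC e).
Definition CBinf_t (i : int) : CBinf e r := sd_inr (shifte e r) (Binf_t r i).
Definition CBinf_s (j : sidx r) : CBinf e r := sd_inr (shifte e r) (Binf_s j).

Lemma CBinf_zt i : CBinf_z * CBinf_t i * CBinf_z^-1 = CBinf_t (i - e%:Z)%R.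
Proof.
rewrite [LHS](sd_conj (shifte e r)) /CBinf_t; congr sd_inr.
rewrite [LHS]shift_t; congr (Binf_t r (i - _)%R).
exact: (zpow_c (Posz e)).
Qed.

Lemma CBinf_zs j : CBinf_z * CBinf_s j * CBinf_z^-1 = CBinf_s j.
Proof.
by rewrite [LHS](sd_conj (shifte e r)) /CBinf_s; congr sd_inr; apply: shift_s.
Qed.

End CBinf.

Inductive Bde_rel (e r : nat) (M : baseUMagmaType) (z t0 t1 : M)
    (s : sidx r -> M) : M -> M -> Prop :=
  | Bde_inf (u v : M) of Binf_rel t0 t1 s u v : Bde_rel e z t0 t1 s u v
  | Bde_ztt : Bde_rel e z t0 t1 s (z * (t1 * t0)) ((t1 * t0) * z)
  | Bde_zalt : Bde_rel e z t0 t1 s (z * altprod t1 t0 e)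
                                   (t0 * z * altprod t1 t0 e.-1)
  | Bde_zs (j : sidx r) : Bde_rel e z t0 t1 s (z * s j) (s j * z).

Inductive Bde_gen (r : nat) : Type :=
  | GenDe_z
  | GenDe_t0
  | GenDe_t1
  | GenDe_s of sidx r.
Arguments GenDe_z {r}.
Arguments GenDe_t0 {r}.
Arguments GenDe_t1 {r}.

Definition Bde_relator (e r : nat) :
    term (Bde_gen r) -> term (Bde_gen r) -> Prop :=
  Bde_rel e (Gen GenDe_z) (Gen GenDe_t0) (Gen GenDe_t1)
            (fun j => Gen (GenDe_s j)).

(* The braid group of G(de,e,r), by the presentation of Broue, Malle and      *)
(* Rouquier; for d >= 2 it does not involve d.                                *)
Definition Bde (d e r : nat) := presented (@Bde_relator e r).
HB.instance Definition _ d e r := Group.on (Bde d e r).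

Section Bde.

Variables d e r : nat.

Definition Bde_z : Bde d e r := pres_gen _ GenDe_z.
Definition Bde_t0 : Bde d e r := pres_gen _ GenDe_t0.
Definition Bde_t1 : Bde d e r := pres_gen _ GenDe_t1.
Definition Bde_s (j : sidx r) : Bde d e r := pres_gen _ (GenDe_s j).
Definition Bde_t (i : int) : Bde d e r := tseq Bde_t0 Bde_t1 i.

End Bde.

(* Main.v *)
Require Import Defs.
From HB Require Import structures.
From mathcomp Require Import all_boot all_order all_algebra.
From mathcomp Require Import boolp.
From mathcomp Require Import zify.

(** Since [t_i t_{i-1}] does not depend on [i], one has
    [<t_i t_{i-1}>^{n+1} = t_{i+n} <t_i t_{i-1}>^n]. Hence, when [z] commutes
    with [t_1 t_0], the relation [z <t_1 t_0>^e = t_0 z <t_1 t_0>^{e-1}] just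
    says [z t_e = t_0 z], which in turn is equivalent to [z t_i z^-1 = t_{i-e}]
    for all [i]. So the presentation of [B(de,e,r)] is the standard presentation
    of the semidirect product, and [x z^n |-> x z^n] is the inverse of [psi]. *)

Set Implicit Arguments.
Unset Strict Implicit.
Unset Printing Implicit Defensive.

Local Open Scope group_scope.

(** * Alternating products and the sequence [t_i] *)

Lemma term_eval_altprod (X : Type) (H : groupType) (f : X -> H)
    (u v : term X) n :
  term_eval f (altprod u v n) = altprod (term_eval f u) (term_eval f v) n.
Proof. by elim: n u v => [|n IH] u v //=; rewrite IH. Qed.

(** Applying [t_{i+1} = t_1 t_0 t_i^-1] twice cancels the inverses and leaves conjugation by
    [t_1 t_0]. *)
Lemma mul_tseq2 (G : groupType) (t0 t1 : G) i :
  t1 * t0 * tseq t0 t1 i = tseq t0 t1 (i + 2)%R * (t1 * t0).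
Proof.
have -> : (i + 2 = i + 1 + 1)%R by lia.
rewrite [in RHS]tseqS tseqS; move: (t1 * t0) => D.
by rewrite invgM invgK !mulgA mulgVK.
Qed.

(** Induction in steps of two: the two leading factors multiply to [t_1 t_0], and moving this past
    [t_{i+n}] turns it into [t_{i+n+2}]. *)
Lemma altprod_tseqS (G : groupType) (t0 t1 : G) i n :
  altprod (tseq t0 t1 i) (tseq t0 t1 (i - 1)%R) n.+1 =
  tseq t0 t1 (i + n%:Z)%R * altprod (tseq t0 t1 i) (tseq t0 t1 (i - 1)%R) n.
Proof.
have altSS m : altprod (tseq t0 t1 i) (tseq t0 t1 (i - 1)%R) m.+2 =
    t1 * t0 * altprod (tseq t0 t1 i) (tseq t0 t1 (i - 1)%R) m.
  by rewrite /= mulgA tseq_spec.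
have [m] := ubnP n; elim: m n => // m IH [|[|n]] lt_nm.
- by rewrite GRing.addr0.
- by rewrite /= !mulg1 tseqS tseq_spec mulgVK.
- rewrite !altSS IH; last by lia.
  rewrite mulgA mul_tseq2 mulgA.
  have -> : (i + n%:Z + 2 = i + n.+2%:Z)%R by lia.
  by rewrite !mulgA.
Qed.

Lemma altprod_relE (G : groupType) (z t0 t1 : G) e :
    (0 < e)%N -> commute z (t1 * t0) ->
  z * altprod t1 t0 e = t0 * z * altprod t1 t0 e.-1 <->
  z * tseq t0 t1 e%:Z = t0 * z.
Proof.
case: e => // e _ zD /=; have := altprod_tseqS t0 t1 1%R e.
rewrite -PoszD add1n tseq1 GRing.subrr /= => ->.
by rewrite mulgA; split=> [/mulIg //|->].
Qed.

(** The sequence [z t_{i+k} z^-1] has the same consecutive products [t_1 t_0] and the same term at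
    0, hence also at 1, so [tseq_unique] identifies it with [t_i]. *)
Lemma conj_tseq (G : groupType) (z t0 t1 : G) k :
    commute z (t1 * t0) -> z * tseq t0 t1 k = t0 * z ->
  forall i, z * tseq t0 t1 i * z^-1 = tseq t0 t1 (i - k)%R.
Proof.
move=> zD zk.
pose t i := z * tseq t0 t1 (i + k)%R * z^-1.
have tD i : t i * t (i - 1)%R = t1 * t0.
  rewrite /t GRing.addrAC !mulgA mulgVK -(mulgA z) tseq_spec.
  by rewrite zD mulgK.
have t0E : t 0%R = t0 by rewrite /t GRing.add0r zk mulgK.
have t1E : t 1%R = t1.
  by apply: (@mulIg _ t0); rewrite -[in LHS]t0E -(tD 1%R) GRing.subrr.
move=> i; rewrite -(tseq_unique t0E t1E tD (i - k)%R) /t.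
by rewrite GRing.subrK.
Qed.

(** * Semidirect products and powers of [z] *)

Lemma semidirect_lift_morph (A G H : groupType) (act : gaction A G)
    (f : G -> H) (g : A -> H) :
    {morph f : x y / x * y} -> {morph g : a b / a * b} ->
    (forall a x, g a * f x = f (act a x) * g a) ->
  {morph (fun u : semidirect act => f (sd_nrm u) * g (sd_act u)) :
    u v / u * v}.
Proof.
move=> fM gM fg [a x] [b y] /=; rewrite fM gM !mulgA.
(* A pair stands for [x a]; in [(x a)(y b)] the hypothesis [fg] moves [g a] past [f y]. *)
by rewrite -(mulgA _ (g a) (f _)) fg !mulgA.
Qed.

Lemma sd_inr_inl (A G : groupType) (act : gaction A G) a x :
  sd_inr act x * sd_inl act a = SemiDirect act a x.
Proof.
change (sd_mul (sd_inr act x) (sd_inl act a) = SemiDirect act a x).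
by rewrite /sd_mul /= gact_one mulg1 mul1g.
Qed.

Lemma zpow_morph (G H : groupType) (f : G -> H) (x : G) n :
  {morph f : x y / x * y} -> f (zpow x n) = zpow (f x) n.
Proof.
move=> fM.
have f1 : f 1 = 1 by apply: (@mulgI _ (f 1)); rewrite -fM !mulg1.
have fV y : f y^-1 = (f y)^-1.
  by apply: (@mulgI _ (f y)); rewrite -fM !mulgV.
elim/int_rec: n => [|n IH|n IH] //.
- by rewrite -addn1 PoszD !zpowS fM IH.
- by rewrite -addn1 PoszD GRing.opprD !zpowP fM fV IH.
Qed.

Lemma zpow_expc e n : zpow (c ^+ e) n = (n * e%:Z)%R.
Proof.
have ce : c ^+ e = Posz e by exact: (zpow_c (Posz e)).
elim/int_rec: n => [|n IH|n IH]; first by rewrite GRing.mul0r.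
- by rewrite -addn1 PoszD zpowS IH ce Cinf_mulE GRing.mulrDl GRing.mul1r.
- rewrite -addn1 PoszD GRing.opprD zpowP IH ce Cinf_mulE.
  by rewrite GRing.mulrDl GRing.mulN1r.
Qed.

Lemma val_zpow_zC e n : val (zpow (zC e) n) = (n * e%:Z)%R :> Cinf.
Proof.
have valeM : {morph (val : Cinfe e -> Cinf) : a b / a * b}.
  by move=> a b; rewrite valM.
by rewrite (zpow_morph (zC e) n valeM) -zpow_expc.
Qed.

(** The exponent of [a] as a power of [z = c^e]: elements of [Cinfe e] are multiples of [e], so for
    [e > 0] the division is exact. *)
Definition Cinfe_log e (a : Cinfe e) : int := ((val a : int) %/ Posz e)%Z.

Lemma zpow_zCK e : (0 < e)%N -> cancel (zpow (zC e)) (@Cinfe_log e).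
Proof. by move=> e0 n; rewrite /Cinfe_log val_zpow_zC mulzK //; lia. Qed.

Lemma Cinfe_logK e : (0 < e)%N -> cancel (@Cinfe_log e) (zpow (zC e)).
Proof.
move=> e0 a; have /asboolP[n an] := valP a.
suff -> : a = zpow (zC e) n by rewrite zpow_zCK.
by apply: val_inj; rewrite an val_zpow_zC zpow_expc.
Qed.

Lemma Cinfe_logM e (a b : Cinfe e) :
  (0 < e)%N -> Cinfe_log (a * b) = (Cinfe_log a + Cinfe_log b)%R.
Proof.
move=> e0; apply: (can_inj (zpow_zCK e0)).
by rewrite zpowD !Cinfe_logK.
Qed.

Lemma Cinfe_log_zC e : (0 < e)%N -> Cinfe_log (zC e) = 1%R.
Proof. by move=> e0; apply: (can_inj (zpow_zCK e0)); rewrite Cinfe_logK. Qed.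

(** * The presentation of [Bde] *)

Definition Bde_val (r : nat) (H : Type) (z t0 t1 : H) (s : sidx r -> H)
    (g : Bde_gen r) : H :=
  match g with
  | GenDe_z => z | GenDe_t0 => t0 | GenDe_t1 => t1 | GenDe_s j => s j
  end.

(** Supplies the hypothesis of [pres_lift]: evaluation respects products by computation, except for
    [altprod], whose length is a variable. *)
Lemma Bde_val_rel e r (H : groupType) (z t0 t1 : H) (s : sidx r -> H) :
    (forall u v, Bde_rel e z t0 t1 s u v -> u = v) ->
  forall u v, Bde_relator e u v ->
    term_eval (Bde_val z t0 t1 s) u = term_eval (Bde_val z t0 t1 s) v.
Proof.
move=> rels u v; case=> {u v} [u v|||j].
- case=> {u v} [i j ij|i j ij|i t i3|j t j4|i i3].
  + exact/rels/Bde_inf/(Binf_ss _ _ _ ij).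
  + exact/rels/Bde_inf/(Binf_sss _ _ _ ij).
  + by case=> ->; apply/rels/Bde_inf/(Binf_s3t _ i3); [left|right].
  + by case=> ->; apply/rels/Bde_inf/(Binf_st _ j4); [left|right].
  + exact/rels/Bde_inf/(Binf_s3tt _ _ _ i3).
- exact/rels/Bde_ztt.
- by rewrite /= !term_eval_altprod; apply/rels/Bde_zalt.
- exact/rels/Bde_zs.
Qed.

Lemma Binf_rel_morph r (G H : groupType) (f : G -> H) (t0 t1 : G)
    (s : sidx r -> G) :
    {morph f : x y / x * y} ->
    (forall u v, Binf_rel t0 t1 s u v -> u = v) ->
  forall u v, Binf_rel (f t0) (f t1) (f \o s) u v -> u = v.
Proof.
move=> fM rels u v; case=> {u v} [i j ij|i j ij|i t i3|j t j4|i i3] /=;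
  rewrite -?fM.
- by rewrite (rels _ _ (Binf_ss _ _ _ ij)).
- by rewrite (rels _ _ (Binf_sss _ _ _ ij)).
- by case=> ->; rewrite -!fM; congr f; apply/rels/(Binf_s3t _ i3); [left|right].
- by case=> ->; rewrite -!fM; congr f; apply/rels/(Binf_st _ j4); [left|right].
- by rewrite (rels _ _ (Binf_s3tt _ _ _ i3)).
Qed.

Lemma Bde_relP d e r (u v : Bde d e r) :
  Bde_rel e (Bde_z d e r) (Bde_t0 d e r) (Bde_t1 d e r) (@Bde_s d e r) u v ->
  u = v.
Proof.
have rel w w' : Bde_relator e w w' ->
    pres_pi (@Bde_relator e r) w = pres_pi _ w'.
  by move=> R; apply/pres_piE/PresRel.
have relI w w' R := rel w w' (Bde_inf _ _ R).
have alt a b n : pres_pi (@Bde_relator e r) (altprod a b n) =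
    altprod (pres_pi _ a) (pres_pi _ b) n.
  by elim: n a b => [|n IH] a b //=; rewrite pres_piM IH.
case=> {u v} [u v|||j].
- case=> {u v} [i j ij|i j ij|i t i3|j t j4|i i3].
  + by have := relI _ _ (Binf_ss _ _ _ ij); rewrite !pres_piM.
  + by have := relI _ _ (Binf_sss _ _ _ ij); rewrite !pres_piM.
  + by case=> ->; [have := relI _ _ (Binf_s3t _ i3 (or_introl erefl))
                  |have := relI _ _ (Binf_s3t _ i3 (or_intror erefl))];
       rewrite !pres_piM.
  + by case=> ->; [have := relI _ _ (Binf_st _ j4 (or_introl erefl))
                  |have := relI _ _ (Binf_st _ j4 (or_intror erefl))];
       rewrite !pres_piM.
  + by have := relI _ _ (Binf_s3tt _ _ _ i3); rewrite !pres_piM.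
- by have := rel _ _ (Bde_ztt _ _ _ _ _); rewrite !pres_piM.
- by have := rel _ _ (Bde_zalt _ _ _ _ _); rewrite !pres_piM !alt.
- by have := rel _ _ (Bde_zs _ _ _ _ _ j); rewrite !pres_piM.
Qed.

(** * The relations of [Bde] in the semidirect product *)

Lemma CBinf_tE e r i :
  CBinf_t e r i = tseq (CBinf_t e r 0%R) (CBinf_t e r 1%R) i.
Proof.
rewrite [LHS](tseq_morph _ _ (@sd_inrM _ _ (shifte e r))).
by rewrite /CBinf_t Binf_t_1.
Qed.

(** This makes [psi] well defined. Conjugation by [z] shifts both indices in [t_1 t_0] by [e], which
    preserves the product; the alternating relation reduces to [z t_e = t_0 z]. *)
Lemma CBinf_rel e r (u v : CBinf e r) : (0 < e)%N ->
  Bde_rel e (CBinf_z e r) (CBinf_t e r 0%R) (CBinf_t e r 1%R) (@CBinf_s e r)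
    u v -> u = v.
Proof.
move=> e0.
have zt i : CBinf_z e r * CBinf_t e r i =
    CBinf_t e r (i - e%:Z)%R * CBinf_z e r.
  by rewrite -CBinf_zt mulgVK.
have zD : commute (CBinf_z e r) (CBinf_t e r 1%R * CBinf_t e r 0%R).
  rewrite /commute mulgA zt -mulgA zt mulgA !(CBinf_tE e r (_ - _)%R).
  have -> : (0 - e%:Z = 1 - e%:Z - 1)%R by lia.
  by rewrite tseq_spec.
case=> {u v} [u v|||j].
- rewrite /CBinf_t Binf_t_1.
  exact: (Binf_rel_morph (@sd_inrM _ _ (shifte e r)) (@Binf_relP r)).
- exact: zD.
- apply/altprod_relE => //; rewrite -CBinf_tE.
  by apply: (@mulIg _ (CBinf_z e r)^-1); rewrite CBinf_zt mulgK GRing.subrr.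
- by apply: (@mulIg _ (CBinf_z e r)^-1); rewrite CBinf_zs mulgK.
Qed.

(** * The homomorphism [psi] and its inverse *)

Theorem corollary3p3 (d e r : nat) (hd : (2 <= d)%N) (hr : (2 <= r)%N)
    (he : (1 <= e)%N) :
  let is_psi (psi : {multiplicative Bde d e r -> CBinf e r}) :=
    [/\ psi (Bde_z d e r) = CBinf_z e r,
        forall i : int, psi (Bde_t d e r i) = CBinf_t e r i
      & forall j : sidx r, psi (Bde_s d e j) = CBinf_s e j] in
  (exists psi, is_psi psi) /\ (forall psi, is_psi psi -> bijective psi).
Proof.
move=> is_psi; split.
  have rels := Bde_val_rel (fun u v => @CBinf_rel e r u v he).
  pose psi : Bde d e r -> CBinf e r :=
    pres_lift (Bde_val (CBinf_z e r) (CBinf_t e r 0%R) (CBinf_t e r 1%R)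
                       (@CBinf_s e r)).
  have psiM : {morph psi : x y / x * y} := pres_liftM rels.
  pose psiH := isMultiplicative.Build (Bde d e r) (CBinf e r) psi psiM.
  pose psi' : {multiplicative Bde d e r -> CBinf e r} := HB.pack psi psiH.
  exists psi'; split=> [|i|j]; first exact: (pres_lift_gen rels).
    rewrite [LHS](tseq_morph _ _ psiM) [RHS]CBinf_tE.
    by congr (tseq _ _ i); apply: (pres_lift_gen rels).
  exact: (pres_lift_gen rels).
move=> psi [psiz psit psis].
have psiM : {morph psi : x y / x * y} by exact: gmulfM.
have bdeP := @Bde_relP d e r.
have relI u v R := bdeP u v (Bde_inf _ _ R).
have zD := bdeP _ _ (Bde_ztt _ _ _ _ _).
have zt : Bde_z d e r * Bde_t d e r e%:Z = Bde_t0 d e r * Bde_z d e r.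
  by apply/altprod_relE => //; apply/bdeP/Bde_zalt.
have zti := conj_tseq zD zt.
(* Every relation of [Binf] is among those of [Bde], so generators may be sent to their
   namesakes. *)
pose iota : Binf r -> Bde d e r :=
  pres_lift (Binf_val (Bde_t0 d e r) (Bde_t1 d e r) (@Bde_s d e r)).
have iotaM : {morph iota : x y / x * y} := pres_liftM (Binf_val_rel relI).
have iota_gen := pres_lift_gen (Binf_val_rel relI).
have iota_t i : iota (Binf_t r i) = Bde_t d e r i.
  by rewrite [LHS](tseq_morph _ _ iotaM); congr (tseq _ _ i); apply: iota_gen.
have iota_s j : iota (Binf_s j) = Bde_s d e j by apply: iota_gen.
have iota_z x : Bde_z d e r * iota x * (Bde_z d e r)^-1 =
    iota (shift r (Posz e) x).
  (* Both sides are multiplicative in [x], so generators suffice; on the [t_i] this is [zti]. *)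
  apply: (Binf_ext (f := fun x => Bde_z d e r * iota x * (Bde_z d e r)^-1)
                   (g := fun x => iota (shift r (Posz e) x))) x => [a b|a b|||j].
  - by rewrite iotaM !mulgA mulgVK.
  - by rewrite gactM iotaM.
  - by rewrite -Binf_t_0 [shift _ _ _]shift_t !iota_t zti.
  - by rewrite -Binf_t_1 [shift _ _ _]shift_t !iota_t zti.
  - rewrite [shift _ _ _]shift_s iota_s.
    by rewrite (bdeP _ _ (Bde_zs _ _ _ _ _ j)) mulgK.
have shiftD (k l : int) x : shift r (k + l)%R x = shift r k (shift r l x).
  exact: (gactA (shift r) k l x).
have iota_zpow n x : zpow (Bde_z d e r) n * iota x =
    iota (shift r (n * e%:Z)%R x) * zpow (Bde_z d e r) n.
  apply: (@mulIg _ (zpow (Bde_z d e r) n)^-1); rewrite mulgK.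
  elim/int_rec: n x => [|n IH|n IH] x.
  - by rewrite GRing.mul0r gact1 /= mul1g invg1 mulg1.
  - rewrite -addn1 PoszD zpowS GRing.mulrDl GRing.mul1r.
    by rewrite shiftD -IH -iota_z invgM !mulgA.
  - rewrite -addn1 PoszD GRing.opprD zpowP GRing.mulrDl GRing.mulN1r.
    (* With [x] written as a shift by [e], [iota_z] produces a factor [z] that cancels the extra
       [z^-1]. *)
    have {1}-> : x = shift r (Posz e) (shift r (- Posz e)%R x).
      by rewrite -shiftD GRing.subrr gact1.
    by rewrite shiftD -IH -iota_z invgM invgK !mulgA !mulgVK.
pose phi (u : CBinf e r) : Bde d e r :=
  iota (sd_nrm u) * zpow (Bde_z d e r) (Cinfe_log (sd_act u)).
have phiM : {morph phi : u v / u * v}.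
  apply: (@semidirect_lift_morph _ _ _ (shifte e r) iota
    (fun a => zpow (Bde_z d e r) (Cinfe_log a))) => // [a b|a x].
    by rewrite Cinfe_logM // zpowD.
  (* The shift by [e] times the exponent of [a] is the shift by the integer [val a], which is how
     [a] acts. *)
  rewrite iota_zpow; congr (iota (shift r _ x) * _).
  by rewrite -val_zpow_zC Cinfe_logK.
have psi_iota x : psi (iota x) = sd_inr (shifte e r) x.
  apply: (Binf_ext (f := fun x => psi (iota x))) x => [a b|||| j].
  - by rewrite iotaM psiM.
  - exact: sd_inrM.
  - by rewrite -Binf_t_0 iota_t psit.
  - by rewrite -Binf_t_1 iota_t psit.
  - by rewrite iota_s psis.
have phi_inr x : phi (sd_inr (shifte e r) x) = iota x.
  by rewrite /phi /= [Cinfe_log 1](zpow_zCK he 0%R) mulg1.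
exists phi => [x|[a x]].
  apply: (pres_morph_ext (f := phi \o psi) (g := id)) x => [a b|//|] /=.
    by rewrite psiM phiM.
  case=> [|||j].
  - rewrite [psi _]psiz /phi /= Cinfe_log_zC //.
    by rewrite [iota 1](pres_lift_pi (Binf_val_rel relI) 1) mul1g.
  - by rewrite [psi _](psit 0%R) phi_inr iota_t.
  (* Unlike index 0, index 1 of [tseq] unfolds to [t_1 t_0 t_0^-1], not to the generator itself. *)
  - rewrite -[pres_gen _ _](tseq1 (Bde_t0 d e r)).
    by rewrite [psi _](psit 1%R) phi_inr iota_t.
  - by rewrite [psi _]psis phi_inr iota_s.
(* For the other composite, [psi] sends [iota x] to [x] and the power of [z] back to [a], giving the
   product [x a]. *)
rewrite psiM psi_iota (zpow_morph _ _ psiM) psiz.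
rewrite -(zpow_morph _ _ (@sd_inlM _ _ (shifte e r))) Cinfe_logK //.
exact: sd_inr_inl.
Qed.
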